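(* Let $M$ be a closed oriented $3$-manifold and $L$ a framed link in $M$. If $(M^*,L^* )$ is obtained from $(M,L)$ by doing a change-of-pair operation, then $M^*\setminus L^*$ is homeomorphic to $M\setminus L$.
   Context: **Change-of-pair operation.** Let $L=L_1\cup\dots\cup L_n$ be a framed link (disjoint embedded annuli; the core curves are the underlying link and the other boundary curves are the parallel copies) in a closed oriented $3$-manifold $M$, and let $(I,J)$ be a partition of $\{1,\dots,n\}$; put $L_I=\cup_{i\in I}L_i$, $L_J=\cup_{j\in J}L_j$. For each $i\in I$ let $L_i^*$ be a framed knot in $M\setminus L$ (with any chosen framing) whose core curve is isotopic to the meridian of a tubular neighborhood of $L_i$, and let $L_I^*=\cup_{i\in I}L_i^*$. The change-of-pair operation $T_{(L_I;L_I^* )}$ sends $(M,L)$ to $(M^*,L^* )$, where $M^*=M_{L_I}$ is the closed $3$-manifold obtained from $M$ by (integral) surgery along the framed link $L_I$, and $L^*=L_I^*\cup L_J$ regarded as a framed link in $M^*$. Complements are complements of the underlying links (core curves).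
   Formalization: The core curves of the L_i^*, i in I, are required to be isotopic to the meridians simultaneously, by one ambient isotopy fixed near L; with separate isotopies for each i the L_i^* could link one another and the claim would fail. *)

(* Defs.v *)
(* The category is the smooth one: M is a topological space with an oriented
   C^oo atlas.  The surgered manifold carries no smooth structure, because only
   its homeomorphism type is used. *)
From HB Require Import structures.
From mathcomp Require Import all_boot all_order all_algebra.
From mathcomp Require Import all_classical all_reals all_analysis.
Import Order.TTheory GRing.Theory Num.Theory.
Import numFieldNormedType.Exports.

Set Implicit Arguments.
Unset Strict Implicit.
Unset Printing Implicit Defensive.

Local Open Scope classical_set_scope.
Local Open Scope ring_scope.

Section HomeomorphicSubspaces.
Variables X Y : topologicalType.

Definition homeomorphic_sets (A : set X) (B : set Y) : Prop :=
  exists (f : X -> Y) (g : Y -> X),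
    [/\ {within A, continuous f}, {within B, continuous g},
        (forall x, A x -> B (f x) /\ g (f x) = x) &
        (forall y, B y -> A (g y) /\ f (g y) = y)].

Definition homeomorphism (f : X -> Y) : Prop :=
  continuous f /\
  exists g : Y -> X, [/\ continuous g, cancel f g & cancel g f].

End HomeomorphicSubspaces.

Section Smooth.
Variables (R : realType) (V W : normedModType R).

Fixpoint Ck (k : nat) (U : set V) (f : V -> W) : Prop :=
  match k with
  | 0 => forall x, U x -> {for x, continuous f}
  | k'.+1 => forall v : V,
      (forall x, U x -> derivable f x v) /\ Ck k' U (fun x => 'D_v f x)
  end.

(* Meaningful for open U only. *)
Definition smooth_on (U : set V) (f : V -> W) : Prop := forall k, Ck k U f.

End Smooth.

Section Manifold.
Variables (R : realType) (M : topologicalType).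

Record chart := Chart {
  chart_dom : set M;
  chart_map : M -> 'rV[R]_3;
  chart_inv : 'rV[R]_3 -> M }.

Definition chart_img (c : chart) : set 'rV[R]_3 :=
  chart_map c @` chart_dom c.

Definition is_chart (c : chart) : Prop :=
  [/\ open (chart_dom c), open (chart_img c),
      {within chart_dom c, continuous (chart_map c)},
      {within chart_img c, continuous (chart_inv c)} &
      forall x, chart_dom c x -> chart_inv c (chart_map c x) = x].

Definition oriented_compatible (c d : chart) : Prop :=
  let U := chart_map c @` (chart_dom c `&` chart_dom d) in
  let t := chart_map d \o chart_inv c in
  smooth_on U t /\ (forall x, U x -> 0 < \det (jacobian t x)).

Definition oriented_atlas (A : set chart) : Prop :=
  [/\ forall c, A c -> is_chart c,
      forall c d, A c -> A d -> oriented_compatible c d &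
      forall x, exists2 c, A c & chart_dom c x].

Definition closed_oriented_3manifold (A : set chart) : Prop :=
  [/\ hausdorff_space M, compact [set: M] & oriented_atlas A].

Definition smooth_immersion (V : normedModType R) (A : set chart)
    (U : set V) (f : V -> M) : Prop :=
  (forall x, U x -> {for x, continuous f}) /\
  forall c, A c ->
    let U_c := U `&` f @^-1` chart_dom c in
    smooth_on U_c (chart_map c \o f) /\
    forall x v, U_c x -> 'D_v (chart_map c \o f) x = 0 -> v = 0.

End Manifold.

Section Models.
Variable R : realType.

Definition plane : Type := (R^o * R^o)%type.

Definition circle : set plane := [set p | p.1 ^+ 2 + p.2 ^+ 2 = 1].
Definition disc : set plane := [set p | p.1 ^+ 2 + p.2 ^+ 2 <= 1].
Definition open_disc : set plane := [set p | p.1 ^+ 2 + p.2 ^+ 2 < 1].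

Definition circle_param (s : R) : plane := (cos s, sin s).

Definition base_point : plane := (1, 0).

End Models.
Arguments circle {R}.
Arguments disc {R}.
Arguments open_disc {R}.
Arguments base_point {R}.

Section FramedLinks.
Variables (R : realType) (M : topologicalType).

(* A framed knot is a parametrized annulus circle x [0, 1] -> M; values
   outside circle x [0, 1] are irrelevant. *)
Definition framed_curve : Type := plane R -> R -> M.

Definition annulus (a : framed_curve) : set M :=
  [set x | exists e t, [/\ circle e, 0 <= t <= 1 & x = a e t]].

Definition core (a : framed_curve) : set M := [set a e 0 | e in circle].

(* Smoothness up to the boundary means local extendability to a smooth
   immersion of an open subset of the (s, t)-plane, s being an angle. *)
Definition embedded_annulus (A : set (chart R M)) (a : framed_curve) : Prop :=
  (forall e e' t t', circle e -> circle e' -> 0 <= t <= 1 -> 0 <= t' <= 1 ->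
     a e t = a e' t' -> e = e' /\ t = t') /\
  (forall s t : R, 0 <= t <= 1 ->
     exists (U : set (plane R)) (b : plane R -> M),
       [/\ open U, U (s, t), smooth_immersion A U b &
           forall p, U p -> 0 <= p.2 <= 1 ->
             a (circle_param p.1) p.2 = b p]).

Definition framed_link (A : set (chart R M)) (n : nat)
    (L : 'I_n -> framed_curve) : Prop :=
  (forall i, embedded_annulus A (L i)) /\
  (forall i j, i != j -> annulus (L i) `&` annulus (L j) = set0).

Definition underlying (n : nat) (L : 'I_n -> framed_curve) : set M :=
  \bigcup_(i in [set: 'I_n]) core (L i).

(* An open tubular neighborhood is parametrized by circle x plane; the closed
   solid torus is circle x disc. *)
Definition tube_param : Type := plane R * plane R -> M.

Definition open_tube (tau : tube_param) : set M :=
  tau @` [set p | circle p.1].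
Definition solid_torus_interior (tau : tube_param) : set M :=
  tau @` [set p | circle p.1 /\ open_disc p.2].
Definition meridian (tau : tube_param) : set M :=
  [set tau (base_point, z) | z in circle].

(* tau is a diffeomorphism from circle x plane onto an open subset of M whose
   zero section is the core of a.  By the last clause the solid torus
   circle x disc meets the annulus a along a sub-annulus circle x [0, d] in
   the direction of base_point, so that circle x {base_point} is a parallel
   copy of the core representing the framing.  Taking d small makes the solid
   torus as thin as desired. *)
Definition tubular_neighborhood (A : set (chart R M)) (a : framed_curve)
    (tau : tube_param) : Prop :=
  [/\ {in [set p | circle p.1] &, injective tau},
      smooth_immersion A [set: R^o * plane R]
        (fun p => tau (circle_param p.1, p.2)),
      (forall O : set (plane R * plane R), open O ->
         open (tau @` (O `&` [set p | circle p.1]))) &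
      exists2 d : R, 0 < d <= 1 &
        forall e (s : R), circle e -> 0 <= s <= 1 ->
          tau (e, (s, 0)) = a e (d * s)].

(* Disjoint tubular neighborhoods of the components indexed by I, away from
   the other components. *)
Definition tubular_system (A : set (chart R M)) (n : nat)
    (L : 'I_n -> framed_curve) (I : {set 'I_n})
    (tau : 'I_n -> tube_param) : Prop :=
  [/\ forall i, i \in I -> tubular_neighborhood A (L i) (tau i),
      (forall i j, i \in I -> j \in I -> i != j ->
         open_tube (tau i) `&` open_tube (tau j) = set0) &
      (forall i j, i \in I -> j \notin I ->
         open_tube (tau i) `&` annulus (L j) = set0)].

Definition exterior (n : nat) (I : {set 'I_n})
    (tau : 'I_n -> tube_param) : set M :=
  ~` \bigcup_(i in [set` I]) solid_torus_interior (tau i).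

(* The isotopy is ambient and supported away from K; it moves all the sets
   C i, i \in I, simultaneously. *)
Definition ambient_isotopic_off (K : set M) (n : nat) (I : {set 'I_n})
    (C C' : 'I_n -> set M) : Prop :=
  exists H : R -> M -> M,
    [/\ {within [set p : R * M | 0 <= p.1 <= 1],
          continuous (fun p : R * M => H p.1 p.2)},
        forall t, 0 <= t <= 1 -> homeomorphism (H t),
        forall x, H 0 x = x,
        (exists W : set M, [/\ open W, K `<=` W &
           forall t x, 0 <= t <= 1 -> W x -> H t x = x]) &
        forall i, i \in I -> H 1 @` C i = C' i].

End FramedLinks.

Section Surgery.
Variables (R : realType) (M N : topologicalType).

(* N is the quotient space of the disjoint union of the exterior and of the
   solid tori disc x circle (i \in I), the boundary point (w, z) of the i-th
   solid torus being identified with tau i (w, z); iota and kappa are the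
   canonical maps into the quotient.  The meridian circle x {base_point} of
   the i-th new solid torus is glued to the framing curve of L i. *)
Definition surgery (n : nat) (I : {set 'I_n}) (tau : 'I_n -> tube_param R M)
    (iota : M -> N) (kappa : 'I_n -> plane R * plane R -> N) : Prop :=
  let E := exterior I tau in
  let V := [set p : plane R * plane R | disc p.1 /\ circle p.2] in
  [/\ forall y, (exists2 x, E x & iota x = y) \/
        (exists i p, [/\ i \in I, V p & kappa i p = y]),
      {in E &, injective iota},
      (forall i j p q, i \in I -> j \in I -> V p -> V q ->
         kappa i p = kappa j q -> i = j /\ p = q),
      (forall x i p, E x -> i \in I -> V p ->
         (iota x = kappa i p <-> circle p.1 /\ x = tau i p)) &
      (forall U : set N, open U <->
         open (iota @^-1` U : set (subspace E)) /\
         (forall i, i \in I -> open (kappa i @^-1` U : set (subspace V))))].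

(* The partition is (I, ~: I).  Lnew is L^* seen in M: it consists of the new
   components L_i^* for i \in I and of L_j for j \notin I. *)
Definition change_of_pair (A : set (chart R M)) (n : nat)
    (L : 'I_n -> framed_curve R M) (Lstar : 'I_n -> framed_curve R N) : Prop :=
  exists (I : {set 'I_n}) (Lnew : 'I_n -> framed_curve R M)
         (tau : 'I_n -> tube_param R M)
         (iota : M -> N) (kappa : 'I_n -> plane R * plane R -> N),
    [/\ framed_link A Lnew,
        (forall j, j \notin I -> Lnew j = L j),
        (forall i, i \in I -> annulus (Lnew i) `&` underlying L = set0),
        tubular_system A L I tau &
    [/\ ambient_isotopic_off R (underlying L) I
          (fun i => core (Lnew i)) (fun i => meridian (tau i)),
        (forall i, annulus (Lnew i) `<=` exterior I tau),
        surgery I tau iota kappa &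
        (forall i e t, circle e -> 0 <= t <= 1 ->
           Lstar i e t = iota (Lnew i e t))]].

End Surgery.

(* Main.v *)
Require Import Defs.
From HB Require Import structures.
From mathcomp Require Import all_boot all_order all_algebra.
From mathcomp Require Import all_classical all_reals all_analysis.
From mathcomp Require Import ring lra.
Import Order.TTheory GRing.Theory Num.Theory.
Import numFieldNormedType.Exports.

(* Away from the cores of L_I the manifolds M and M^* are the same space.  The
   ambient isotopy from L_I^* to the meridians is the identity near L, so its
   final homeomorphism h is the identity near the cores of L_I; it therefore
   induces a homeomorphism of M^* which is the identity near the cores of the
   new solid tori.  It replaces L_I^* by the meridians, which lie on the boundary
   of the new solid tori, as the circles {1} x S^1.  The i-th new solid torus
   together with the punctured tube of L_i is an open solid torus R^2 x S^1 in
   M^*; pushing 1 to 0 in R^2 by a compactly supported homeomorphism moves the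
   meridian onto the core {0} x S^1, whose complement is the punctured tube of
   L_i in M.

   Homeomorphisms between open subsets are handled through their graphs, which
   makes gluing them a union and composing them a composition of relations. *)

Set Implicit Arguments.
Unset Strict Implicit.
Unset Printing Implicit Defensive.

Local Open Scope classical_set_scope.
Local Open Scope ring_scope.

(** * Polar coordinates in the plane *)

Lemma cvg_pair_to (T : Type) (F : set_system T) {FF : Filter F}
    (U V : topologicalType) (f : T -> U) (g : T -> V) (a : U) (b : V) :
  f @ F --> a -> g @ F --> b -> (fun x => (f x, g x)) @ F --> (a, b).
Proof. by move=> fa gb; apply: cvg_pair. Qed.

Section PlaneGeometry.
Variable R : realType.
Implicit Types (p q e v w : plane R) (s t : R).

Definition norm2 p : R := Num.sqrt (p.1 ^+ 2 + p.2 ^+ 2).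
Definition scale s p : plane R := (s * p.1, s * p.2).
Definition unit_dir p : plane R := scale (norm2 p)^-1 p.

Lemma norm2_ge0 p : 0 <= norm2 p.
Proof. exact: sqrtr_ge0. Qed.

Lemma norm2_sqr p : norm2 p ^+ 2 = p.1 ^+ 2 + p.2 ^+ 2.
Proof. by rewrite sqr_sqrtr // addr_ge0 // sqr_ge0. Qed.

Lemma norm2_scale s p : 0 <= s -> norm2 (scale s p) = s * norm2 p.
Proof.
move=> s0; rewrite /norm2 /= !exprMn -mulrDr sqrtrM ?sqr_ge0//.
by rewrite sqrtr_sqr ger0_norm.
Qed.

Lemma scale1 p : scale 1 p = p.
Proof. by case: p => x y; rewrite /scale !mul1r. Qed.

Lemma scaleA s t p : scale s (scale t p) = scale (s * t) p.
Proof. by rewrite /scale /= !mulrA. Qed.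

Lemma norm2_eq0 p : norm2 p = 0 -> p = 0.
Proof.
case: p => x y h; have := norm2_sqr (x, y); rewrite h expr0n /= => /esym/eqP.
rewrite paddr_eq0 ?sqr_ge0// !sqrf_eq0 => /andP[/eqP -> /eqP ->]; by [].
Qed.

Lemma norm20 : norm2 0 = 0.
Proof. by rewrite /norm2 /= expr0n addr0 sqrtr0. Qed.

Lemma norm2_gt0 p : p != 0 -> 0 < norm2 p.
Proof.
move=> p0; rewrite lt_neqAle norm2_ge0 andbT eq_sym.
by apply: contra p0 => /eqP/norm2_eq0 ->.
Qed.

Lemma circleE p : circle p <-> norm2 p = 1.
Proof.
rewrite /circle /=; split=> [h|h]; first by rewrite /norm2 h sqrtr1.
by rewrite -norm2_sqr h expr1n.
Qed.

Lemma discE p : disc p <-> norm2 p <= 1.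
Proof.
by rewrite /disc /= -norm2_sqr expr_le1 ?norm2_ge0.
Qed.

Lemma open_discE p : open_disc p <-> norm2 p < 1.
Proof.
by rewrite /open_disc /= -norm2_sqr expr_lt1 ?norm2_ge0.
Qed.

Lemma norm2_circle_neq0 p : circle p -> p != 0.
Proof.
move=> /circleE h; apply/eqP => p0; move: h.
by rewrite p0 norm20 => /eqP; rewrite eq_sym oner_eq0.
Qed.

Lemma norm2_unit p : p != 0 -> norm2 (unit_dir p) = 1.
Proof.
move=> /norm2_gt0 p0; rewrite norm2_scale ?invr_ge0 ?norm2_ge0//.
by rewrite mulVf // gt_eqF.
Qed.

Lemma circle_unit p : p != 0 -> circle (unit_dir p).
Proof. by move=> /norm2_unit /circleE. Qed.

Lemma unit_circle p : circle p -> unit_dir p = p.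
Proof. by move=> /circleE h; rewrite /unit_dir h invr1 scale1. Qed.

Lemma unitK p : p != 0 -> scale (norm2 p) (unit_dir p) = p.
Proof.
by move=> /norm2_gt0 p0; rewrite /unit_dir scaleA divff ?scale1// gt_eqF.
Qed.

Lemma scale_neq0 s p : s != 0 -> p != 0 -> scale s p != 0.
Proof.
case: p => x y s0; apply: contra => /eqP [/eqP] + /eqP.
by rewrite !mulf_eq0 (negbTE s0) /= => /eqP -> /eqP ->.
Qed.

Lemma unit_scale s p : 0 < s -> unit_dir (scale s p) = unit_dir p.
Proof.
move=> s0; rewrite /unit_dir norm2_scale ?ltW// scaleA invfM.
by rewrite mulrAC mulVf ?mul1r// gt_eqF.
Qed.

Lemma norm2_continuous : continuous norm2.
Proof.
move=> p; apply: continuous_comp; last exact: sqrt_continuous.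
by apply: cvgD; apply: cvgM; first [exact: cvg_fst | exact: cvg_snd].
Qed.

Lemma scale_cvg (T : Type) (F : set_system T) {FF : Filter F}
    (f : T -> R) (g : T -> plane R) (s : R) (p : plane R) :
  f @ F --> s -> g @ F --> p -> (fun x => scale (f x) (g x)) @ F --> scale s p.
Proof.
move=> fs gp.
apply: cvg_pair_to; apply: cvgM => //.
- exact: (cvg_comp _ _ gp (@cvg_fst _ _ _ _ _)).
- exact: (cvg_comp _ _ gp (@cvg_snd _ _ _ _ _)).
Qed.

Lemma unit_continuous p : p != 0 -> {for p, continuous unit_dir}.
Proof.
move=> p0.
apply: (@scale_cvg _ (nbhs p) _ (fun q => (norm2 q)^-1) id); last exact: cvg_id.
by apply: cvgV; [rewrite gt_eqF ?norm2_gt0| exact: norm2_continuous].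
Qed.

(* On circle x plane and plane x circle these are mutually inverse: they
   exchange the polar coordinates of the two plane factors. *)
Definition polar_swap (p : plane R * plane R) : plane R * plane R :=
  (unit_dir p.1, scale (norm2 p.1) (unit_dir p.2)).
Definition polar_swap' (p : plane R * plane R) : plane R * plane R :=
  (scale (norm2 p.2) (unit_dir p.1), unit_dir p.2).

Lemma polar_swap_continuous (p : plane R * plane R) : p.1 != 0 -> p.2 != 0 ->
  {for p, continuous polar_swap}.
Proof.
move=> p1 p2; apply: cvg_pair_to.
  by apply: (cvg_comp _ _ (@cvg_fst _ _ _ _ _)); exact: unit_continuous.
apply: scale_cvg.
  by apply: (cvg_comp _ _ (@cvg_fst _ _ _ _ _)); exact: norm2_continuous.
by apply: (cvg_comp _ _ (@cvg_snd _ _ _ _ _)); exact: unit_continuous.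
Qed.

Lemma polar_swap'_continuous (p : plane R * plane R) : p.1 != 0 -> p.2 != 0 ->
  {for p, continuous polar_swap'}.
Proof.
move=> p1 p2; apply: cvg_pair_to.
  apply: scale_cvg.
    by apply: (cvg_comp _ _ (@cvg_snd _ _ _ _ _)); exact: norm2_continuous.
  by apply: (cvg_comp _ _ (@cvg_fst _ _ _ _ _)); exact: unit_continuous.
by apply: (cvg_comp _ _ (@cvg_snd _ _ _ _ _)); exact: unit_continuous.
Qed.

(** [polar_swap] forgets the length of [p.2], so the round trip returns that coordinate normalized;
    on plane x circle, away from [p.1 = 0], it is the identity. *)
Lemma polar_swapK (p : plane R * plane R) : p.1 != 0 -> p.2 != 0 ->
  polar_swap' (polar_swap p) = (p.1, unit_dir p.2).
Proof.
case: p => w z /= w0 z0; rewrite /polar_swap' /polar_swap /=.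
have ww := norm2_gt0 w0.
rewrite norm2_scale ?norm2_ge0// norm2_unit// mulr1 unit_scale//.
rewrite (unit_circle (circle_unit w0)) (unit_circle (circle_unit z0)).
by rewrite unitK.
Qed.

Lemma polar_swap'K (p : plane R * plane R) : p.1 != 0 -> p.2 != 0 ->
  polar_swap (polar_swap' p) = (unit_dir p.1, p.2).
Proof.
case: p => w z /= w0 z0; rewrite /polar_swap' /polar_swap /=.
have zz := norm2_gt0 z0.
rewrite norm2_scale ?norm2_ge0// norm2_unit// mulr1 unit_scale//.
rewrite (unit_circle (circle_unit w0)) (unit_circle (circle_unit z0)).
by rewrite unitK.
Qed.

Lemma norm2_polar_swap (p : plane R * plane R) : p.2 != 0 ->
  norm2 (polar_swap p).2 = norm2 p.1.
Proof. by move=> p2; rewrite norm2_scale ?norm2_ge0// norm2_unit// mulr1. Qed.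

Lemma norm2_polar_swap' (p : plane R * plane R) : p.1 != 0 ->
  norm2 (polar_swap' p).1 = norm2 p.2.
Proof. by move=> p2; rewrite norm2_scale ?norm2_ge0// norm2_unit// mulr1. Qed.

Lemma polar_swap_unit (w z : plane R) : z != 0 ->
  polar_swap (w, unit_dir z) = polar_swap (w, z).
Proof. by move=> z0; rewrite /polar_swap /= (unit_circle (circle_unit z0)). Qed.

(* The angle of e relative to circle_param s is the arctangent of a quotient of
   coordinates in the basis rotated by s. *)
Lemma angle_near (s : R) (e0 : plane R) : circle_param s = unit_dir e0 -> e0 != 0 ->
  exists phi : plane R -> R, [/\ phi e0 = s, {for e0, continuous phi} &
    \forall e \near e0, unit_dir e = circle_param (phi e)].
Proof.
move=> [hc hs] e00; set c := cos s in hc; set d := sin s in hs.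
have cd : c ^+ 2 + d ^+ 2 = 1 by rewrite cos2Dsin2.
pose X e := c * e.1 + d * e.2; pose Y e := c * e.2 - d * e.1.
have n0 := norm2_gt0 e00.
have e0E : e0 = scale (norm2 e0) (c, d) by rewrite hc hs -[LHS]unitK.
have X0 : X e0 = norm2 e0.
  rewrite {1}e0E /X /scale /=; transitivity (norm2 e0 * (c ^+ 2 + d ^+ 2)); first ring.
  by rewrite cd mulr1.
have Y0 : Y e0 = 0 by rewrite e0E /Y /scale /=; ring.
have Xc : {for e0, continuous X}.
  by apply: cvgD; apply: cvgM; (exact: cvg_cst || exact: cvg_fst || exact: cvg_snd).
have Yc : {for e0, continuous Y}.
  by apply: cvgB; apply: cvgM; (exact: cvg_cst || exact: cvg_fst || exact: cvg_snd).
exists (fun e => s + atan (Y e / X e)); split.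
- by rewrite Y0 mul0r atan0 addr0.
- apply: cvgD; first exact: cvg_cst.
  apply: (continuous_comp (f := fun e => Y e / X e)); last exact: continuous_atan.
  apply: cvgM => //; apply: cvgV => //; first by rewrite X0 gt_eqF.
(* The arctangent gives the right angle only on the half-plane [X e > 0], which contains a
   neighborhood of [e0] because [X e0 = norm2 e0 > 0]. *)
have Xpos : \forall e \near e0, 0 < X e.
  have : \forall x \near X e0, 0 < x by apply: lt_nbhsr; rewrite X0.
  exact: Xc.
near=> e.
have Xe : 0 < X e by near: e.
have e1 : X e != 0 by rewrite gt_eqF.
set t := Y e / X e.
have t2 : 1 + t ^+ 2 = (norm2 e / X e) ^+ 2.
  have XY : X e ^+ 2 + Y e ^+ 2 = e.1 ^+ 2 + e.2 ^+ 2.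
    transitivity ((c ^+ 2 + d ^+ 2) * (e.1 ^+ 2 + e.2 ^+ 2)).
      by rewrite /X /Y; ring.
    by rewrite cd mul1r.
  by rewrite /t !expr_div_n norm2_sqr -XY; field.
have st : Num.sqrt (1 + t ^+ 2) = norm2 e / X e.
  by rewrite t2 sqrtr_sqr ger0_norm// divr_ge0 ?norm2_ge0// ltW.
have ct : cos (atan t) = X e / norm2 e by rewrite cos_atan st invf_div.
have sint : sin (atan t) = Y e / norm2 e.
  have /(congr1 (fun x => x * cos (atan t))) := atanK t.
  rewrite /tan mulfVK; last by rewrite gt_eqF// cos_gt0_pihalf// atan_gtNpi2 atan_ltpi2.
  by move=> ->; rewrite ct /t mulrA mulfVK.
rewrite /circle_param cosD sinD ct sint /unit_dir /scale -/c -/d.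
congr pair.
  rewrite !mulrA -mulrBl mulrC; congr (_ * _).
  transitivity ((c ^+ 2 + d ^+ 2) * e.1); first by rewrite cd mul1r.
  by rewrite /X /Y; ring.
rewrite !mulrA -mulrDl mulrC; congr (_ * _).
transitivity ((c ^+ 2 + d ^+ 2) * e.2); first by rewrite cd mul1r.
by rewrite /X /Y; ring.
Unshelve. all: by end_near. Qed.

Lemma circle_paramP e : circle e -> exists s, circle_param s = e.
Proof.
case: e => x y; rewrite /circle /= => h.
have x1 : -1 <= x <= 1.
  by apply/andP; split; nra.
case: (leP 0 y) => y0.
  exists (acos x); rewrite /circle_param acosK ?in_itv//= sin_acos//; congr pair.
  by rewrite -h addrAC subrr add0r sqrtr_sqr ger0_norm.
exists (- acos x); rewrite /circle_param cosN sinN acosK ?in_itv//= sin_acos//.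
by rewrite -h addrAC subrr add0r sqrtr_sqr ltr0_norm// opprK.
Qed.

Lemma circle_compact : compact (@circle R).
Proof.
apply: (@subclosed_compact _ (@circle R)
  (`[-1, 1]%classic `*` `[-1, 1]%classic)).
- have -> : @circle R = norm2 @^-1` [set 1].
    by apply/seteqP; split => p /circleE.
  by apply: preimage_closed => [p _|]; [exact: norm2_continuous|exact: closed_eq].
- by apply: compact_setX; exact: segment_compact.
- by move=> [x y]; rewrite /circle /= !in_itv /= => h; split; nra.
Qed.

Lemma ball_compact (r : R) : compact [set p : plane R | norm2 p <= r].
Proof.
apply: (@subclosed_compact _ ([set p : plane R | norm2 p <= r])
  (`[- r, r]%classic `*` `[- r, r]%classic)).
- have -> : [set p : plane R | norm2 p <= r] = norm2 @^-1` [set x | x <= r] by [].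
  by apply: preimage_closed => [p _|]; [exact: norm2_continuous|exact: closed_le].
- by apply: compact_setX; exact: segment_compact.
- move=> p /= h; have := norm2_sqr p; have := norm2_ge0 p.
  by rewrite !in_itv /= => *; split; nra.
Qed.

End PlaneGeometry.

(** * A compactly supported homeomorphism of the plane *)

Section PointPush.
Variable R : realType.

(** For [s >= 0] the graph of [f s] is the broken line through (-2s, -2s), (0, -s) and (2s, 2s),
    continued by the diagonal on both sides; [g s] is the inverse broken line. *)
Let f (s t : R) : R := Num.min t (Num.max (3 / 2 * t - s) (t / 2 - s)).
Let g (s u : R) : R := Num.max u (Num.min (2 / 3 * (u + s)) (2 * (u + s))).
Let height (y : R) : R := Num.max 0 (1 - `|y| / 2).

(* On each horizontal line, a piecewise linear homeomorphism supported in
   |x - 1| <= 2 height y; it moves the point (1, 0) to the origin. *)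
Definition push (p : plane R) : plane R := (1 + f (height p.2) (p.1 - 1), p.2).
Definition pull (p : plane R) : plane R := (1 + g (height p.2) (p.1 - 1), p.2).

Let height_ge0 y : 0 <= height y.
Proof. by rewrite /height le_max lexx. Qed.

Let fK s t : 0 <= s -> g s (f s t) = t.
Proof.
move=> s0; rewrite /f /g.
case: (leP (3 / 2 * t - s) (t / 2 - s)) => h1.
  case: (leP t (t / 2 - s)) => h2.
    case: (leP (2 / 3 * (t + s)) (2 * (t + s))) => h3; case: leP => h4; lra.
  by case: (leP (2 / 3 * (t / 2 - s + s))) => h3; case: leP => h4; lra.
case: (leP t (3 / 2 * t - s)) => h2.
  case: (leP (2 / 3 * (t + s)) (2 * (t + s))) => h3; case: leP => h4; lra.
by case: (leP (2 / 3 * (3 / 2 * t - s + s))) => h3; case: leP => h4; lra.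
Qed.

Let gK s t : 0 <= s -> f s (g s t) = t.
Proof.
move=> s0; rewrite /f /g.
case: (leP (2 / 3 * (t + s)) (2 * (t + s))) => h1.
  case: (leP t (2 / 3 * (t + s))) => h2.
    by case: (leP (_ - s)) => h3; case: leP => h4; lra.
  by case: (leP (_ - s)) => h3; case: leP => h4; lra.
case: (leP t (2 * (t + s))) => h2.
  by case: (leP (_ - s)) => h3; case: leP => h4; lra.
by case: (leP (_ - s)) => h3; case: leP => h4; lra.
Qed.

Let add1B (a : R) : 1 + a - 1 = a.
Proof. by lra. Qed.

Let add1B' (a : R) : 1 + (a - 1) = a.
Proof. by lra. Qed.

Lemma pushK : cancel push pull.
Proof. by move=> [x y]; rewrite /push /pull /= add1B fK// add1B'. Qed.

Lemma pullK : cancel pull push.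
Proof. by move=> [x y]; rewrite /push /pull /= add1B gK// add1B'. Qed.

Lemma push_base : push base_point = 0.
Proof.
rewrite /push /f /height /=; congr pair.
rewrite subrr normr0 !mul0r mulr0 subr0 (max_r ler01) maxxx min_r; lra.
Qed.

(** The support lies in the square |x - 1| <= 2, |y| <= 2, whose points have norm at most the square
    root of 13, which is less than 4. *)
Lemma push_far (p : plane R) : 4 < norm2 p -> push p = p.
Proof.
case: p => x y h; have := norm2_sqr (x, y); rewrite /push /=; move: h.
set n := norm2 _ => h e; congr pair.
have h16 : 16 < x ^+ 2 + y ^+ 2 by nra.
case: (leP 2 `|y|) => y2.
  have -> : height y = 0 by rewrite /height max_l//; lra.
  by rewrite /f; case: (leP (3 / 2 * _ - _)) => ?; case: leP => ?; lra.
have [yl yr] : - 2 < y /\ y < 2 by move: y2; rewrite ltr_norml => /andP[].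
have x3 : (x < -3) \/ (3 < x).
  by case: (ltP x (-3)) => ?; [left|right; nra].
have y0 : 0 <= `|y| by [].
have -> : height y = 1 - `|y| / 2 by rewrite /height max_r//; lra.
by rewrite /f; case: x3 => ?; case: (leP (3 / 2 * _ - _)) => ?; case: leP => ?; lra.
Qed.

Let cvg_max (T : Type) (F : set_system T) {FF : Filter F} (a b : T -> R) (x y : R) :
  a @ F --> x -> b @ F --> y -> (fun t => Num.max (a t) (b t)) @ F --> Num.max x y.
Proof.
move=> ax bY; rewrite maxr_absE; under eq_fun do rewrite maxr_absE.
apply: cvgM; last exact: cvg_cst.
by apply: cvgD; [exact: cvgD|apply: cvg_norm; exact: cvgB].
Qed.

Let cvg_min (T : Type) (F : set_system T) {FF : Filter F} (a b : T -> R) (x y : R) :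
  a @ F --> x -> b @ F --> y -> (fun t => Num.min (a t) (b t)) @ F --> Num.min x y.
Proof.
move=> ax bY; rewrite minr_absE; under eq_fun do rewrite minr_absE.
apply: cvgM; last exact: cvg_cst.
by apply: cvgB; [exact: cvgD|apply: cvg_norm; exact: cvgB].
Qed.

Let height_cvg (p : plane R) : (fun q : plane R => height q.2) @ p --> height p.2.
Proof.
apply: cvg_max; first exact: cvg_cst.
apply: cvgB; first exact: cvg_cst.
by apply: cvgM; [apply: cvg_norm; exact: cvg_snd|exact: cvg_cst].
Qed.

Let fst1_cvg (p : plane R) : (fun q : plane R => q.1 - 1) @ p --> p.1 - 1.
Proof. by apply: cvgB; [exact: cvg_fst|exact: cvg_cst]. Qed.

Lemma push_continuous : continuous push.
Proof.
move=> p; apply: cvg_pair_to; last exact: cvg_snd.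
apply: cvgD; first exact: cvg_cst.
apply: cvg_min; first exact: fst1_cvg.
have tc := @fst1_cvg p; have hc := @height_cvg p.
apply: cvg_max; (apply: cvgB; last exact: hc).
  by apply: cvgM; [exact: cvg_cst|exact: tc].
by apply: cvgM; [exact: tc|exact: cvg_cst].
Qed.

Lemma pull_continuous : continuous pull.
Proof.
move=> p; apply: cvg_pair_to; last exact: cvg_snd.
apply: cvgD; first exact: cvg_cst.
apply: cvg_max; first exact: fst1_cvg.
have tc := @fst1_cvg p; have hc := @height_cvg p.
by apply: cvg_min; (apply: cvgM; [exact: cvg_cst|exact: cvgD]).
Qed.

End PointPush.

(** * Graphs of partial homeomorphisms *)

Section Correspondences.

(** Lower semicontinuity of a set-valued map. Taking [V] to be the whole space shows that the domain
    of [C] is open; for a functional [C] the condition is then continuity on that domain. In this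
    form it is stable under unions as well as compositions. *)
Definition lsc (X Y : topologicalType) (C : X -> Y -> Prop) : Prop :=
  forall x y, C x y -> forall V, nbhs y V ->
    nbhs x [set x' | exists2 y', V y' & C x' y'].

Definition functional (X Y : Type) (C : X -> Y -> Prop) : Prop :=
  forall x y y', C x y -> C x y' -> y = y'.

Definition converse (X Y : Type) (C : X -> Y -> Prop) : Y -> X -> Prop :=
  fun y x => C x y.

(* The graph of a homeomorphism between open subsets of X and Y. *)
Definition local_homeo (X Y : topologicalType) (C : X -> Y -> Prop) : Prop :=
  [/\ lsc C, lsc (converse C), functional C & functional (converse C)].

Lemma lsc_comp (X Y Z : topologicalType) (C : X -> Y -> Prop) (D : Y -> Z -> Prop) :
  lsc C -> lsc D -> lsc (fun x z => exists2 y, C x y & D y z).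
Proof.
move=> lC lD x z [y Cxy Dyz] V Vz; have := lC _ _ Cxy _ (lD _ _ Dyz _ Vz).
apply: filterS => x' [y' [z' Vz' Dy'z'] Cx'y'].
by exists z' => //; exists y'.
Qed.

Lemma lsc_ext (X Y : topologicalType) (C D : X -> Y -> Prop) :
  (forall x y, C x y <-> D x y) -> lsc C -> lsc D.
Proof.
move=> CD lC x y /CD Cxy V Vy; apply: filterS (lC _ _ Cxy _ Vy).
by move=> x' [y' Vy' /CD]; exists y'.
Qed.

Lemma lsc_or (X Y : topologicalType) (C D : X -> Y -> Prop) :
  lsc C -> lsc D -> lsc (fun x y => C x y \/ D x y).
Proof.
move=> lC lD x y [Cxy|Dxy] V Vy.
  by apply: filterS (lC _ _ Cxy _ Vy) => x' [y' Vy' ?]; exists y' => //; left.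
by apply: filterS (lD _ _ Dxy _ Vy) => x' [y' Vy' ?]; exists y' => //; right.
Qed.

Lemma local_homeo_comp (X Y Z : topologicalType)
    (C : X -> Y -> Prop) (D : Y -> Z -> Prop) :
  local_homeo C -> local_homeo D ->
  local_homeo (fun x z => exists2 y, C x y & D y z).
Proof.
move=> [C1 C2 C3 C4] [D1 D2 D3 D4]; split.
- exact: lsc_comp.
- apply: lsc_ext (lsc_comp D2 C2) => z x; rewrite /converse.
  by split=> -[y]; exists y.
- move=> x z z' [y Cy Dy] [y' Cy' Dy'].
  by rewrite (C3 _ _ _ Cy Cy') in Dy; exact: D3 Dy Dy'.
- move=> z x x' [y Cy Dy] [y' Cy' Dy'].
  by rewrite (D4 _ _ _ Dy Dy') in Cy; exact: C4 Cy Cy'.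
Qed.

(** The given map only supplies values outside the domain of [C]; that domain being open, these
    values do not affect continuity at its points. *)
Lemma lsc_function (X Y : topologicalType) (C : X -> Y -> Prop) :
  lsc C -> functional C -> (X -> Y) ->
  exists f : X -> Y, forall x y, C x y -> f x = y /\ {for x, continuous f}.
Proof.
move=> lC fC d.
have [f fP] : {f : X -> Y & forall x, (exists y, C x y) -> C x (f x)}.
  apply: (@choice _ _ (fun x y => (exists y, C x y) -> C x y)) => x.
  have [[y Cy]|nC] := pselect (exists y, C x y).
    by exists y.
  by exists (d x).
have fE x y : C x y -> f x = y.
  by move=> Cxy; exact: (fC _ _ _ (fP _ (ex_intro _ y Cxy)) Cxy).
exists f => x y Cxy; split; first exact: fE.
move=> V; rewrite (fE _ _ Cxy) => Vy.
apply: filterS (lC _ _ Cxy _ Vy) => x' [y' Vy' Cx'].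
by rewrite /= (fE _ _ Cx').
Qed.

Lemma local_homeo_homeomorphic (X Y : topologicalType) (C : X -> Y -> Prop)
    (A : set X) (B : set Y) :
  local_homeo C -> (X -> Y) -> (Y -> X) ->
  (forall x, A x -> exists2 y, B y & C x y) ->
  (forall y, B y -> exists2 x, A x & C x y) ->
  homeomorphic_sets A B.
Proof.
move=> [C1 C2 C3 C4] dXY dYX AC BC.
have [f fP] := lsc_function C1 C3 dXY; have [g gP] := lsc_function C2 C4 dYX.
exists f, g; split.
- apply: continuous_in_subspaceT => x /set_mem /AC [y _ Cxy].
  by have [] := fP _ _ Cxy.
- apply: continuous_in_subspaceT => y /set_mem /BC [x _ Cxy].
  by have [] := gP _ _ Cxy.
- by move=> x /AC [y By Cxy]; rewrite (fP _ _ Cxy).1 (gP _ _ Cxy).1.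
- by move=> y /BC [x Ax Cxy]; rewrite (gP _ _ Cxy).1 (fP _ _ Cxy).1.
Qed.

(* If h moves only points outside W, the partial homeomorphism obtained from it
   by transport along Q extends by the identity over every point of Y all of
   whose nearby Q-partners lie in W. *)
Definition transport (Y X : topologicalType) (Q : Y -> X -> Prop) (h : X -> X)
    (W : set X) (y y' : Y) : Prop :=
  (exists2 x, Q y x & Q y' (h x)) \/
  (y = y' /\ interior [set y | forall x, Q y x -> W x] y).

(** The relation is the union of [Q] followed by [h] and the converse of [Q], and of the identity of
    an open set [O]. Over [O] all partners lie in [W], where [h] is the identity, so the two pieces
    agree on their overlap. *)
Lemma transport_local_homeo (Y X : topologicalType) (Q : Y -> X -> Prop)
    (h : X -> X) (W : set X) :
  local_homeo Q -> homeomorphism h -> (forall x, W x -> h x = x) ->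
  local_homeo (transport Q h W).
Proof.
move=> [Q1 Q2 Q3 Q4] [hc [g [gc gK hK]]] hW.
pose O := interior [set y | forall x, Q y x -> W x].
have Oopen : open O by exact: open_interior.
have OP y x : O y -> Q y x -> W x by move=> /interior_subset; exact.
have Did : lsc (fun y y' : Y => y = y' /\ O y).
  move=> y _ [<- Oy] V Vy; have Oy' := open_nbhs_nbhs (conj Oopen Oy).
  by apply: filterS (filterI Vy Oy') => y' [Vy' ?]; exists y'.
split.
- apply: lsc_or Did.
  have hh : lsc (fun x x' : X => x' = h x).
    move=> x _ -> V Vhx; have hV : nbhs x (h @^-1` V) := hc _ _ Vhx.
    apply: filterS hV => x' /= ?.
    by exists (h x').
  apply: lsc_ext (lsc_comp (lsc_comp Q1 hh) Q2) => y y'; split.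
    by move=> [x' [x Qx ->] Qx']; exists x.
  by move=> [x Qx Qx']; exists (h x) => //; exists x.
- have gg : lsc (fun x x' : X => x = h x').
    move=> _ x -> V Vx; have Vghx : nbhs (g (h x)) V by rewrite gK.
    have gV : nbhs (h x) (g @^-1` V) := gc _ _ Vghx.
    by apply: filterS gV => x' /= ?; exists (g x') => //; rewrite hK.
  have L := lsc_comp (lsc_comp Q1 gg) Q2.
  apply: lsc_ext (lsc_or L Did) => y y'; rewrite /converse /transport; split.
    move=> [[x' [x Qx xE] Qx']|[-> Oy]]; last by right.
    by left; exists x' => //; rewrite -xE.
  move=> [[x Qx Qx']|[-> Oy]]; last by right.
  by left; exists x => //; exists (h x).
- move=> y y1 y2 [[x Qx Qx1]|[<- Oy]] [[x' Qx' Qx2]|[<- Oy2]] //.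
  + by rewrite (Q3 _ _ _ Qx Qx') in Qx1; exact: Q4 Qx1 Qx2.
  + by rewrite hW in Qx1; [exact: Q4 Qx1 Qx|exact: OP Qx].
  + by rewrite hW in Qx2; [exact: Q4 Qx' Qx2|exact: OP Qx'].
(* Here it is [h x], not [x], that is known to lie in [W]; injectivity of [h] turns the fixed point
   [h x] into [x]. *)
- have fixed y x : O y -> Q y (h x) -> h x = x.
    move=> Oy Qx; apply: (can_inj gK); apply: hW; exact: OP Qx.
  move=> y y1 y2 [[x Qx Qx1]|[E1 Oy]] [[x' Qx' Qx2]|[E2 Oy2]].
  + have := Q3 _ _ _ Qx1 Qx2 => /(can_inj gK) xx; rewrite xx in Qx.
    exact: Q4 Qx Qx'.
  + by subst y2; have hx := fixed _ _ Oy2 Qx1; rewrite hx in Qx1; exact: Q4 Qx Qx1.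
  + by subst y1; have hx := fixed _ _ Oy Qx2; rewrite hx in Qx2; exact: Q4 Qx2 Qx'.
  + by rewrite E1 E2.
Qed.

End Correspondences.

(** * Tubular neighborhoods *)

Section Tubes.
Variables (R : realType) (M : topologicalType).
Implicit Types (tau : tube_param R M) (p q : plane R * plane R).

(* tau is relevant on circle x plane only; composing with the radial projection
   makes it continuous and open near every p with p.1 != 0. *)
Definition tube tau p : M := tau (unit_dir p.1, p.2).

Lemma tube_circle tau p : circle p.1 -> tube tau p = tau p.
Proof. by case: p => e v /= ce; rewrite /tube unit_circle. Qed.

Lemma near_fst (U V : topologicalType) (p : U * V) (P : set U) :
  nbhs p.1 P -> nbhs p [set q | P q.1].
Proof. by move=> Pp; apply: (@cvg_fst _ _ (nbhs p.1) (nbhs p.2)). Qed.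

Lemma near_snd (U V : topologicalType) (p : U * V) (P : set V) :
  nbhs p.2 P -> nbhs p [set q | P q.2].
Proof. by move=> Pp; apply: (@cvg_snd _ _ (nbhs p.1) (nbhs p.2)). Qed.

Lemma near_neq0 (p : plane R) : p != 0 -> \forall q \near p, q != 0.
Proof.
move=> /norm2_gt0 p0.
have pos : \forall x \near norm2 p, 0 < x by exact: lt_nbhsr.
have H : nbhs p (@norm2 R @^-1` [set x | 0 < x]).
  exact: (@norm2_continuous R p _ pos).
apply: filterS H => q /= q0.
by apply/eqP => qE; move: q0; rewrite qE norm20 ltxx.
Qed.

Variables (A : set (chart R M)) (a : framed_curve R M) (tau : tube_param R M).
Hypothesis tauN : tubular_neighborhood A a tau.

(** The immersion clause gives continuity in the angle, not in the point of the circle; a continuous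
    local choice [phi] of the angle translates one into the other. *)
Lemma tube_continuous p : p.1 != 0 -> {for p, continuous (tube tau)}.
Proof.
move=> p1; have [_ [Fc _] _ _] := tauN.
have [s sE] := circle_paramP (circle_unit p1).
have [phi [phip phic phin]] := angle_near sE p1.
pose F := fun q : R^o * plane R => tau (circle_param q.1, q.2).
have FE : \forall q \near p, F (phi q.1, q.2) = tube tau q.
  by apply: filterS (near_fst phin) => q /= qE; rewrite /F /tube /= qE.
have FG : (fun q => F (phi q.1, q.2)) @ p --> F (phi p.1, p.2).
  apply: (@cvg_comp _ _ _ (fun q => (phi q.1, q.2) : R^o * plane R) F
    _ (nbhs (phi p.1, p.2))).
    apply: cvg_pair_to; last exact: cvg_snd.
    apply: (@cvg_comp _ _ _ (fst : plane R * plane R -> _) phi _ (nbhs p.1)).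
      exact: cvg_fst.
    exact: phic.
  exact: Fc.
have FEp : F (phi p.1, p.2) = tube tau p by exact: nbhs_singleton FE.
rewrite FEp in FG.
apply: cvg_trans FG; apply: near_eq_cvg; exact: FE.
Qed.

Lemma tube_open p (O : set (plane R * plane R)) : p.1 != 0 -> nbhs p O ->
  nbhs (tube tau p) (tube tau @` (O `&` [set q | q.1 != 0])).
Proof.
move=> p1 pO; have [U [Uo Up] UO] : exists2 B, open_nbhs p B & B `<=` O.
  by move: pO; rewrite nbhsE.
 have [_ _ opn _] := tauN.
(* The openness clause for [tau] sees only points over the unit circle; [D] rescales them to the
   radius of [p.1], where the neighborhood [O] is given. *)
pose D (q : plane R * plane R) : plane R * plane R := (scale (norm2 p.1) q.1, q.2).
have Dc : continuous D.
  move=> q; apply: cvg_pair_to; last exact: cvg_snd.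
  apply: scale_cvg; [exact: cvg_cst|exact: cvg_fst].
have DO : open (D @^-1` U) by apply: open_comp => // q _; exact: Dc.
have n1 := norm2_gt0 p1.
have : nbhs (tube tau p) (tau @` ((D @^-1` U) `&` [set q | circle q.1])).
  apply: open_nbhs_nbhs; split; first exact: opn.
  exists (unit_dir p.1, p.2); last by [].
  by split; [rewrite /D /= unitK//; case: (p) Up|exact: circle_unit].
apply: filterS => _ [q [Oq cq] <-]; exists (D q).
  split; first exact: UO.
  by apply: scale_neq0; [rewrite gt_eqF|exact: norm2_circle_neq0].
by rewrite /tube /D /= unit_scale// unit_circle//; case: (q).
Qed.

Lemma tube_ball_compact (r : R) :
  compact (tau @` [set p | circle p.1 /\ norm2 p.2 <= r]).
Proof.
have -> : tau @` [set p | circle p.1 /\ norm2 p.2 <= r] =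
          tube tau @` (circle `*` [set v | norm2 v <= r]).
  by apply/seteqP; split => _ [p [cp pr] <-]; exists p => //; rewrite tube_circle.
apply: continuous_compact.
  apply: continuous_in_subspaceT => p /set_mem [cp _].
  by apply: tube_continuous; exact: norm2_circle_neq0.
by apply: compact_setX; [exact: circle_compact|exact: ball_compact].
Qed.

Lemma core_tube : core a = tau @` [set p | circle p.1 /\ p.2 = 0].
Proof.
have [_ _ _ [d _ dE]] := tauN.
have E e : circle e -> tau (e, 0) = a e 0.
  by move=> ce; have := dE e 0 ce; rewrite mulr0 lexx ler01; apply.
apply/seteqP; split => [_ [e ce <-]|_ [[e v] /= [ce ->] <-]].
  by exists (e, 0) => //; exact: E.
by exists e => //; rewrite E.
Qed.

(** The tube lemma: the circle is compact and [tube tau] is continuous along the zero section, so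
    one radius works for all [e]. *)
Lemma thin_tube (W : set M) : open W -> core a `<=` W ->
  nbhs (0 : plane R) [set v | forall e, circle e -> W (tau (e, v))].
Proof.
move=> Wo; rewrite core_tube => coreW.
have := proj1 (compact_near_coveringP _) (@circle_compact R).
move=> /(_ _ (nbhs (0 : plane R)) (fun v e => circle e -> W (tau (e, v))) _) H.
have : \forall v \near (0 : plane R), @circle R `<=` (fun e => circle e -> W (tau (e, v))).
  apply: H => e ce.
  have e0 := norm2_circle_neq0 ce.
  have We : nbhs (tube tau (e, 0)) W.
    apply: open_nbhs_nbhs; split => //; apply: coreW.
    by rewrite tube_circle//; exists (e, 0).
  have Wn : nbhs ((e, 0) : plane R * plane R) (tube tau @^-1` W).
    exact: tube_continuous We.
  by apply: filterS Wn => -[e' v] /= Wt ce'; rewrite -[tau _]tube_circle.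
by apply: filterS => v /= h e ce; exact: h.
Qed.

End Tubes.

(** * The surgered manifold *)

Section SurgeryCharts.
Variables (R : realType) (M N : topologicalType) (A : set (chart R M)) (n : nat).
Variables (L : 'I_n -> framed_curve R M) (I : {set 'I_n}).
Variables (tau : 'I_n -> tube_param R M) (iota : M -> N).
Variable (kappa : 'I_n -> plane R * plane R -> N).
Hypothesis hM : hausdorff_space M.
Hypothesis tauS : tubular_system A L I tau.
Hypothesis surg : surgery I tau iota kappa.
Implicit Types (p q : plane R * plane R) (i j : 'I_n).

Let E := exterior I tau.

Lemma tau_inj i j p q : i \in I -> j \in I -> circle p.1 -> circle q.1 ->
  tau i p = tau j q -> i = j /\ p = q.
Proof.
have [tauN disj _] := tauS; move=> iI jI cp cq tpq.
have [ij|ij] := eqVneq i j; last first.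
  have : (open_tube (tau i) `&` open_tube (tau j)) (tau i p).
    by split; [exists p | rewrite tpq; exists q].
  by rewrite disj.
subst j; split => //; have [inj _ _ _] := tauN _ iI.
by apply: inj tpq; rewrite inE.
Qed.

Lemma exterior_tube i p : i \in I -> circle p.1 -> E (tau i p) <-> 1 <= norm2 p.2.
Proof.
move=> iI cp; split=> [Ep|p1].
  rewrite leNgt; apply/negP => /open_discE p1; apply: Ep; exists i => //.
  by exists p.
move=> [j /= jI [q [cq /open_discE q1]]] /(tau_inj jI iI cq cp) [_ qp].
by move: q1; rewrite qp ltNge p1.
Qed.

(** Closed tubes are removed here, open ones in [exterior]. They are compact, hence closed when [M]
    is Hausdorff, so [far r] is open; for [r >= 1] it is a part of the exterior to which the
    quotient topology restricts well. *)
Definition far (r : R) : set M :=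
  ~` \bigcup_(i in [set` I]) (tau i @` [set p | circle p.1 /\ norm2 p.2 <= r]).

Lemma far_tube r i p : i \in I -> circle p.1 -> far r (tau i p) <-> r < norm2 p.2.
Proof.
move=> iI cp; split=> [Ep|p1].
  by rewrite ltNge; apply/negP => p1; apply: Ep; exists i => //; exists p.
move=> [j /= jI [q [cq q1]]] /(tau_inj jI iI cq cp) [_ qp].
by move: q1; rewrite qp leNgt p1.
Qed.

Lemma far_exterior r : 1 <= r -> far r `<=` E.
Proof.
move=> r1 x fx [i iI [p [cp /open_discE pd]] px]; apply: fx.
by exists i => //; exists p => //; split=> //; apply: le_trans r1; exact: ltW.
Qed.

Lemma far_mono r s : r <= s -> far s `<=` far r.
Proof.
move=> rs x; apply: contra_not => -[i iI [p [cp pr] px]].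
by exists i => //; exists p => //; split => //; exact: le_trans pr rs.
Qed.

Lemma far_open r : open (far r).
Proof.
rewrite openC; apply: closed_bigcup => // i iI; apply: compact_closed => //.
have [tauN _ _] := tauS; have tN := tauN i iI.
exact: (tube_ball_compact tN).
Qed.

Lemma far_or_tube r x : far r x \/ exists i p, [/\ i \in I, circle p.1 & x = tau i p].
Proof.
have [|/contrapT [i iI [p [cp _] <-]]] := pselect (far r x); first by left.
by right; exists i, p.
Qed.

(* The core of the i-th new solid torus together with the punctured i-th tube:
   an open subset of N parametrized by plane x circle.  As for tube, the circle
   coordinate is thickened to the punctured plane. *)
Definition new_tube i p : N :=
  if norm2 p.1 <= 1 then kappa i (p.1, unit_dir p.2) else iota (tau i (polar_swap p)).

Let circle_swap p : p.1 != 0 -> circle (polar_swap p).1.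
Proof. exact: circle_unit. Qed.

Let norm2_ge1_neq0 (v : plane R) : 1 <= norm2 v -> v != 0.
Proof. by apply: contraL => /eqP ->; rewrite norm20 -ltNge ltr01. Qed.

Lemma exterior_swap i p : i \in I -> p.2 != 0 -> 1 <= norm2 p.1 -> E (tau i (polar_swap p)).
Proof.
move=> iI p2 p1; have p10 := norm2_ge1_neq0 p1.
by apply/exterior_tube => //; [exact: circle_swap|rewrite norm2_polar_swap].
Qed.

(** The definition gives this for [norm2 p.1 > 1]; on the torus [norm2 p.1 = 1] the two branches
    agree by the gluing relation. *)
Lemma new_tube_iota i p : i \in I -> p.2 != 0 -> 1 <= norm2 p.1 ->
  new_tube i p = iota (tau i (polar_swap p)).
Proof.
move=> iI p2 p1; rewrite /new_tube; case: ifPn => // p1'.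
have p1E : norm2 p.1 = 1 by apply/eqP; rewrite eq_le p1' p1.
have cp : circle p.1 by apply/circleE.
have -> : polar_swap p = (p.1, unit_dir p.2) by rewrite /polar_swap p1E scale1 unit_circle.
have [_ _ _ gl _] := surg; symmetry; apply/gl => //.
- by apply/exterior_tube => //=; rewrite norm2_unit.
- by split; [apply/discE|exact: circle_unit].
Qed.

Lemma iota_new_tube x i p : E x -> i \in I -> p.2 != 0 -> iota x = new_tube i p ->
  1 <= norm2 p.1 /\ x = tau i (polar_swap p).
Proof.
have [_ inj _ gl _] := surg; move=> Ex iI p2; rewrite /new_tube; case: ifPn => p1.
  move=> /gl [] //; first by split; [exact/discE|exact: circle_unit].
  move=> /= cp ->; have /circleE p1E := cp; split; first by rewrite p1E.
  by rewrite /polar_swap p1E scale1 (unit_circle cp).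
rewrite -ltNge in p1; move=> /inj -> //; first by rewrite ltW.
- by rewrite inE.
- by rewrite inE; apply: exterior_swap => //; exact: ltW.
Qed.

Let swap_inj p q : p.1 != 0 -> p.2 != 0 -> q.1 != 0 -> q.2 != 0 ->
  polar_swap p = polar_swap q -> p.1 = q.1 /\ unit_dir p.2 = unit_dir q.2.
Proof.
move=> p1 p2 q1 q2 /(congr1 (@polar_swap' R)).
by rewrite !polar_swapK// => e; split; [exact: (congr1 fst e)|exact: (congr1 snd e)].
Qed.

Lemma new_tube_inj i j p q : i \in I -> j \in I -> p.2 != 0 -> q.2 != 0 ->
  new_tube i p = new_tube j q -> [/\ i = j, p.1 = q.1 & unit_dir p.2 = unit_dir q.2].
Proof.
have outer i' j' p' q' : i' \in I -> j' \in I -> p'.2 != 0 -> q'.2 != 0 ->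
    1 <= norm2 p'.1 -> new_tube i' p' = new_tube j' q' ->
    [/\ i' = j', p'.1 = q'.1 & unit_dir p'.2 = unit_dir q'.2].
  move=> iI jI p2 q2 p1; rewrite new_tube_iota//.
  have Ep := exterior_swap iI p2 p1.
  move=> /(iota_new_tube Ep jI q2) [q1].
  have p10 := norm2_ge1_neq0 p1; have q10 := norm2_ge1_neq0 q1.
  move=> /(tau_inj iI jI (circle_swap p10) (circle_swap q10)) [ij].
  by move=> /(swap_inj p10 p2 q10 q2) [].
move=> iI jI p2 q2; case: (leP 1 (norm2 p.1)) => p1; first exact: outer.
case: (leP 1 (norm2 q.1)) => q1.
  by move=> /esym /(outer _ _ _ _ jI iI q2 p2 q1) [].
have [_ _ inj _ _] := surg; rewrite /new_tube !ltW// => /inj [] //.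
- by split; [apply/discE; exact: ltW|exact: circle_unit].
- by split; [apply/discE; exact: ltW|exact: circle_unit].
- by move=> -> e; split => //; [exact: (congr1 fst e)|exact: (congr1 snd e)].
Qed.

Lemma new_tube_unit i (w z : plane R) : z != 0 ->
  new_tube i (w, unit_dir z) = new_tube i (w, z).
Proof.
by move=> z0; rewrite /new_tube /= polar_swap_unit// unit_circle//; exact: circle_unit.
Qed.

Lemma new_tube_disc i p : disc p.1 -> circle p.2 -> new_tube i p = kappa i p.
Proof.
by case: p => w z /= /discE wd zc; rewrite /new_tube /= wd unit_circle.
Qed.

Let trace_nbhs (T : topologicalType) (V U : set T) (x : T) :
  open (U : set (subspace V)) -> U x -> V x -> nbhs x [set y | V y -> U y].
Proof.
move=> /open_subspaceP [G Go GVE] Ux Vx.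
have Gx : (G `&` V) x by rewrite GVE.
have : nbhs x G by apply: open_nbhs_nbhs; split => //; case: Gx.
apply: filterS => y Gy Vy.
by have [] : (U `&` V) y by rewrite -GVE.
Qed.

Lemma iota_continuous x : far 1 x -> {for x, continuous iota}.
Proof.
move=> fx U Ux; have [G [Go Gx] GU] : exists2 G, open_nbhs (iota x) G & G `<=` U.
  by move: Ux; rewrite nbhsE.
have [_ _ _ _ top] := surg; have [top1 _] := (proj1 (top G) Go).
have Ex : E x by exact: far_exterior fx.
have far_nbhs : nbhs x (far 1) by apply: open_nbhs_nbhs; split => //; exact: far_open.
apply: filterS (filterI far_nbhs (trace_nbhs top1 Gx Ex)) => y [fy Uy].
by apply: GU; apply: Uy; exact: far_exterior fy.
Qed.

(** Openness in the quotient is tested on preimages. The preimage in a solid torus is empty: points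
    glued to its boundary lie at radius exactly 1 in a tube, hence outside [far 1]. *)
Lemma iota_open x V : far 1 x -> nbhs x V -> nbhs (iota x) (iota @` V).
Proof.
move=> fx Vx; have [_ inj _ gl top] := surg.
pose U := interior V `&` far 1.
have Uo : open U by apply: openI; [exact: open_interior|exact: far_open].
have UE y : U y -> E y by move=> [_ /far_exterior]; apply.
suff Xo : open (iota @` U).
  have : nbhs (iota x) (iota @` U).
    by apply: open_nbhs_nbhs; split => //; exists x.
  by apply: filterS => _ [y [/interior_subset Vy _] <-]; exists y.
apply/top; split=> [|i iI]; apply/open_subspaceP.
  exists U => //; apply/seteqP; split => y [Uy Ey]; split => //; first by exists y.
  case: Uy => z Uz /inj <-//; rewrite inE//; exact: UE.
exists set0; first exact: open0.
rewrite set0I; apply/esym; rewrite -subset0 => p [[y Uy] + Vp].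
move=> /gl [|//|//|cp yp]; first exact: UE.
have [_ fy] := Uy; move: fy; rewrite yp => /far_tube -/(_ iI cp).
by case: Vp => _ /circleE ->; rewrite ltxx.
Qed.

(** Pasting along the torus [norm2 p.1 = 1]: the part [norm2 q.1 <= 1] is governed by [kappa], the
    part [norm2 q.1 > 1] by [iota], and a part whose closure misses [p] is empty near [p]. *)
Lemma new_tube_continuous i p : i \in I -> p.2 != 0 ->
  {for p, continuous (new_tube i)}.
Proof.
move=> iI p2 U Up.
have [G [Go Gp] GU] : exists2 G, open_nbhs (new_tube i p) G & G `<=` U.
  by move: Up; rewrite nbhsE.
have [_ _ _ _ top] := surg; have [top1 top2] := (proj1 (top G) Go).
have norm_cvg : (fun q => norm2 q.1) @ p --> norm2 p.1.
  by apply: (cvg_comp _ _ (@cvg_fst _ _ _ _ _)); exact: norm2_continuous.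
have inner : \forall q \near p, norm2 q.1 <= 1 -> G (new_tube i q).
  have [p1|p1] := leP (norm2 p.1) 1; last first.
    have far1 : \forall x \near norm2 p.1, 1 < x by exact: lt_nbhsr.
    have : nbhs p [set q | 1 < norm2 q.1] := norm_cvg _ far1.
    by apply: filterS => q /= q1; rewrite leNgt q1.
  pose g q : plane R * plane R := (q.1, unit_dir q.2).
  have gc : {for p, continuous g}.
    apply: cvg_pair_to; first exact: cvg_fst.
    by apply: (cvg_comp _ _ (@cvg_snd _ _ _ _ _)); exact: unit_continuous.
  have Vtp : (kappa i @^-1` G) (g p) by move: Gp; rewrite /new_tube p1.
  have Vp : disc (g p).1 /\ circle (g p).2.
    by split; [exact/discE|exact: circle_unit].
  have H : nbhs p (g @^-1` [set r | disc r.1 /\ circle r.2 -> G (kappa i r)]).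
    exact: (gc _ (trace_nbhs (top2 i iI) Vtp Vp)).
  apply: filterS (filterI H (near_snd (near_neq0 p2))) => q /= [Uq q2] q1.
  by rewrite /new_tube q1; apply: Uq; split; [exact/discE|exact: circle_unit].
have outer : \forall q \near p, 1 < norm2 q.1 -> G (new_tube i q).
  have [p1|p1] := ltP (norm2 p.1) 1.
    have near1 : \forall x \near norm2 p.1, x < 1 by exact: lt_nbhsl.
    have : nbhs p [set q | norm2 q.1 < 1] := norm_cvg _ near1.
    by apply: filterS => q /= q1; rewrite ltNge ltW.
  have p10 := norm2_ge1_neq0 p1.
  have Vtp : (iota @^-1` G) (tau i (polar_swap p)) by rewrite /= -new_tube_iota.
  have Ep := exterior_swap iI p2 p1.
  have [tauN _ _] := tauS.
  have sc : {for p, continuous (fun q => tube (tau i) (polar_swap q))}.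
    apply: (@continuous_comp _ _ _ (@polar_swap R) (tube (tau i))).
      exact: (polar_swap_continuous p10 p2).
    by apply: (tube_continuous (tauN _ iI)); exact: norm2_circle_neq0 (circle_swap p10).
  have := trace_nbhs top1 Vtp Ep; rewrite -tube_circle; last exact: circle_swap.
  move=> Et.
  have H : nbhs p ((fun q => tube (tau i) (polar_swap q)) @^-1`
    [set x | E x -> G (iota x)]).
    exact: (sc _ Et).
  apply: filterS (filterI H (near_snd (near_neq0 p2))) => q /= [+ q2] q1.
  rewrite tube_circle; last by apply: circle_swap; apply: norm2_ge1_neq0; exact: ltW.
  by move=> Uq; rewrite new_tube_iota ?ltW//; apply: Uq; apply: exterior_swap; rewrite ?ltW.
apply: filterS (filterI inner outer) => q [q1 q2]; apply: GU.
by case: (leP (norm2 q.1) 1).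
Qed.

Lemma new_tube_open i p V : i \in I -> p.2 != 0 -> nbhs p V ->
  nbhs (new_tube i p) (new_tube i @` (V `&` [set q | q.2 != 0])).
Proof.
move=> iI p2 Vp; have [_ inj _ gl top] := surg; have [tauN _ _] := tauS.
(* [new_tube] sees only the direction of [q.2], so the interior of [V] is saturated under rescaling
   of [q.2]; among the points with nonzero second coordinate, [S] is then the full preimage of its
   image. *)
pose S := [set r : plane R * plane R | r.2 != 0 /\ exists q,
  [/\ interior V q, q.2 != 0, r.1 = q.1 & unit_dir r.2 = unit_dir q.2]].
have So : open S.
  rewrite openE => r [r2 [q [Vq q2 rq1 rq2]]].
  pose D (r' : plane R * plane R) : plane R * plane R :=
    (r'.1, scale (norm2 q.2) (unit_dir r'.2)).
  have Dr : D r = q by rewrite /D rq1 rq2 unitK//; case: (q).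
  have Dc : {for r, continuous D}.
    apply: cvg_pair_to; first exact: cvg_fst.
    apply: scale_cvg; first exact: cvg_cst.
    by apply: (cvg_comp _ _ (@cvg_snd _ _ _ _ _)); exact: unit_continuous.
  have Vn : nbhs (D r) (interior V).
    by rewrite Dr; apply: open_nbhs_nbhs; split => //; exact: open_interior.
  have H : nbhs r (D @^-1` interior V) := Dc _ Vn.
  apply: filterS (filterI H (near_snd (near_neq0 r2))) => r' /= [Vr' r'2].
  split=> //; exists (D r'); split => //=.
    by apply: scale_neq0;
    [rewrite gt_eqF ?norm2_gt0|exact: norm2_circle_neq0 (circle_unit r'2)].
  by rewrite unit_scale ?norm2_gt0// (unit_circle (circle_unit r'2)).
have SV r : S r -> (new_tube i @` (V `&` [set q | q.2 != 0])) (new_tube i r).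
  move=> [r2 [q [/interior_subset Vq q2 rq1 rq2]]]; exists q => //.
  rewrite (surjective_pairing q) (surjective_pairing r) -rq1.
  by rewrite -new_tube_unit// -rq2 new_tube_unit.
have Sunit r : S r -> S (r.1, unit_dir r.2).
  move=> [r2 [q [Vq q2 rq1 rq2]]]; split => /=.
    exact: norm2_circle_neq0 (circle_unit r2).
  by exists q; split => //; rewrite (unit_circle (circle_unit r2)).
suff Xo : open (new_tube i @` S).
  have : nbhs (new_tube i p) (new_tube i @` S).
    apply: open_nbhs_nbhs; split => //; exists p => //; split=> //.
    by exists p; split => //.
  by apply: filterS => _ [q Sq <-]; exact: SV.
apply/top; split=> [|j jI]; apply/open_subspaceP.
  (* [T] is [S] rewritten in the coordinates of the old tube; its image under [tube (tau i)] is a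
     neighborhood of each exterior point that [iota] sends into the set under test. *)
  pose T := @polar_swap' R @^-1` S `&` [set q : plane R * plane R | q.1 != 0 /\ q.2 != 0].
  exists (interior (tube (tau i) @` T)); first exact: open_interior.
  apply/seteqP; split => y [Uy Ey]; split => //.
    have [q [Uq [q1 q2]] qy] := interior_subset Uy.
    subst y; exists (polar_swap' q) => //.
    have cq : circle (unit_dir q.1) by exact: circle_unit.
    have /(exterior_tube iI) := Ey => /(_ cq) /= q21.
    by rewrite new_tube_iota ?norm2_polar_swap' ?polar_swap'K//; case: Uq.
  have [q Sq /esym yq] := Uy; have [q2 _] := Sq.
  have [q1 yE] := iota_new_tube Ey iI q2 yq.
  have q10 := norm2_ge1_neq0 q1.
  have sq1 : (polar_swap q).1 != 0 by exact: norm2_circle_neq0 (circle_swap q10).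
  have sq2 : (polar_swap q).2 != 0.
    apply: scale_neq0; first by rewrite gt_eqF ?norm2_gt0.
    exact: norm2_circle_neq0 (circle_unit q2).
  rewrite yE -tube_circle; last exact: circle_swap.
  have Sn : nbhs (polar_swap' (polar_swap q)) S.
    by rewrite polar_swapK//; apply: open_nbhs_nbhs; split => //; exact: Sunit.
  have Tn : nbhs (polar_swap q) T.
    apply: filterI; first exact: (polar_swap'_continuous sq1 sq2 Sn).
    apply: filterI; first exact: (near_fst (near_neq0 sq1)).
    exact: (near_snd (near_neq0 sq2)).
  apply: filterS (tube_open (tauN _ iI) sq1 Tn).
  by move=> _ [r [Tr _] <-]; exists r.
have kE r : disc r.1 /\ circle r.2 -> kappa j r = new_tube j r.
  by case: r => r1 r2 [/= /discE d c]; rewrite /new_tube /= d unit_circle.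
have [ij|ij] := eqVneq i j; last first.
  exists set0; first exact: open0.
  rewrite set0I; apply/esym; rewrite -subset0 => r [[q [q2 _]] + Vr].
  have r2 : r.2 != 0 by case: Vr => _ /norm2_circle_neq0.
  rewrite kE// => /(new_tube_inj iI jI q2 r2) [ij' _ _].
  by move: ij; rewrite ij' eqxx.
subst j; exists S => //.
apply/seteqP; split => r [Sr Vr]; split => //; first by exists r => //; rewrite kE.
have r2 : r.2 != 0 by case: Vr => _ /norm2_circle_neq0.
case: Sr => q [q2 [q' [Vq' q'2 qq1 qq2]]]; rewrite kE//.
move=> /(new_tube_inj iI iI q2 r2) [_ rq1 rq2].
by split=> //; exists q'; split => //; rewrite -?rq1 -?rq2.
Qed.

End SurgeryCharts.

(** * Exchanging solid tori *)

Section TubeExchange.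
Variables (R : realType) (M N : topologicalType) (A : set (chart R M)) (n : nat).
Variables (L : 'I_n -> framed_curve R M) (I : {set 'I_n}).
Variables (tau : 'I_n -> tube_param R M) (iota : M -> N).
Variable (kappa : 'I_n -> plane R * plane R -> N).
Hypothesis hM : hausdorff_space M.
Hypothesis tauS : tubular_system A L I tau.
Hypothesis surg : surgery I tau iota kappa.

Local Notation far := (far I tau).
Local Notation new_tube := (new_tube tau iota kappa).

(* The graph of a homeomorphism between the complements of the circles
   th w = 0 in the new solid tori and of the cores of the tubes: the identity
   far away, th times the identity of the circle in polar coordinates. *)
Definition tube_exchange (r : R) (th : plane R -> plane R) (y : N) (x : M) : Prop :=
  (far r x /\ y = iota x) \/
  exists i (p : plane R * plane R), [/\ i \in I, p.2 != 0, th p.1 != 0,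
    y = new_tube i p & x = tau i (polar_swap (th p.1, p.2))].

Lemma iota_polar (x : M) i (p : plane R * plane R) : i \in I -> circle p.1 ->
  x = tau i p -> exterior I tau x ->
  [/\ (polar_swap' p).1 != 0, (polar_swap' p).2 != 0 &
    iota x = new_tube i (polar_swap' p)].
Proof.
move=> iI cp xE; rewrite xE => /(exterior_tube tauS iI cp) p2.
have p20 : p.2 != 0 by apply: contraTneq p2 => ->; rewrite norm20 -ltNge ltr01.
have p10 := norm2_circle_neq0 cp.
have s2 : (polar_swap' p).2 != 0 := norm2_circle_neq0 (circle_unit p20).
split=> //.
  by apply: scale_neq0;
    [rewrite gt_eqF ?norm2_gt0|exact: norm2_circle_neq0 (circle_unit p10)].
rewrite (new_tube_iota tauS surg)//; last by rewrite norm2_polar_swap'.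
by rewrite polar_swap'K// (unit_circle cp) -surjective_pairing.
Qed.

Lemma far_or_new_tube r y : (exists2 x, far r x & y = iota x) \/
  exists i (p : plane R * plane R), [/\ i \in I, p.2 != 0 & y = new_tube i p].
Proof.
have [cover _ _ _ _] := surg; have [[x Ex <-]|[i [p [iI [dp cp] <-]]]] := cover y.
  have [fx|[i [p [iI cp xE]]]] := far_or_tube I tau r x; first by left; exists x.
  by right; have [_ s2 ->] := iota_polar iI cp xE Ex; exists i, (polar_swap' p).
by right; exists i, p; rewrite new_tube_disc//; split=> //; exact: norm2_circle_neq0.
Qed.

Section TubeExchangeHomeo.
Variables (r : R) (th th' : plane R -> plane R).
Hypotheses (r1 : 1 <= r) (thc : continuous th) (thc' : continuous th').
Hypotheses (thK : cancel th th') (thK' : cancel th' th).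
Hypothesis th_far : forall w, r < norm2 w -> th w = w.

Let far_new_tube x i (p : plane R * plane R) : far r x -> i \in I -> p.2 != 0 ->
  iota x = new_tube i p ->
  r < norm2 p.1 /\ x = tau i (polar_swap p).
Proof.
move=> fx iI p2 /(iota_new_tube tauS surg (far_exterior r1 fx) iI p2) [p1 xE].
have p10 : p.1 != 0.
  by apply: contraTneq p1 => ->; rewrite norm20 -ltNge ltr01.
split=> //; move: fx; rewrite xE => /(far_tube tauS _ iI).
by move/(_ (circle_unit p10)); rewrite norm2_polar_swap.
Qed.

Let pair_th (p : plane R * plane R) : r < norm2 p.1 -> (th p.1, p.2) = p.
Proof. by move=> /th_far ->; case: p. Qed.

(** Where the two clauses overlap, [p.1] has norm greater than [r], so [th] fixes it and both
    clauses name the same point. *)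
Let tube_exchange_functional : functional (tube_exchange r th).
Proof.
have [_ inj _ _ _] := surg; move=> y x x' [[fx ->]|[i [p [iI p2 p1 -> ->]]]].
  move=> [[fx' /inj]|[i [p [iI p2 p1 /(far_new_tube fx iI p2) [rp ->] ->]]]].
    by apply; rewrite inE; exact: far_exterior r1 _ _.
  by rewrite pair_th.
move=> [[fx' /esym /(far_new_tube fx' iI p2) [rp ->]]|]; first by rewrite pair_th.
move=> [j [q [jI q2 q1 /(new_tube_inj tauS surg iI jI p2 q2) [-> e1 e2] ->]]].
by congr (tau j _); rewrite /polar_swap /= e1 e2.
Qed.

Let tube_exchange_injective : functional (converse (tube_exchange r th)).
Proof.
have mixed x i (p : plane R * plane R) :
    far r x -> i \in I -> p.2 != 0 -> th p.1 != 0 ->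
    x = tau i (polar_swap (th p.1, p.2)) -> iota x = new_tube i p.
  move=> fx iI p2 p1 xE; move: fx; rewrite xE => /(far_tube tauS _ iI).
  move/(_ (circle_unit p1)); rewrite norm2_polar_swap//= => rp.
  (* The bound concerns [th p.1], which [th] therefore fixes; cancelling one [th] gives the
     claim. *)
  have thp : th p.1 = p.1 by apply: (can_inj thK); rewrite th_far.
  rewrite thp -surjective_pairing (new_tube_iota tauS surg)//.
  by rewrite -thp; apply: le_trans r1 (ltW rp).
move=> x y y' [[fx ->]|[i [p [iI p2 p1 -> xE]]]].
  by move=> [[_ ->]//|[i [p [iI p2 p1 -> xE]]]]; exact: mixed.
move=> [[fx ->]|[j [q [jI q2 q1 -> ]]]]; first by apply/esym; exact: mixed.
have cp : circle (polar_swap (th p.1, p.2)).1 := circle_unit p1.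
have cq : circle (polar_swap (th q.1, q.2)).1 := circle_unit q1.
rewrite xE => /(tau_inj tauS iI jI cp cq) [<-].
move=> /(congr1 (@polar_swap' R)); rewrite !polar_swapK//= => e.
have e1 : p.1 = q.1 by apply: (can_inj thK); exact: (congr1 fst e).
have e2 : unit_dir p.2 = unit_dir q.2 by exact: (congr1 snd e).
rewrite (surjective_pairing p) (surjective_pairing q) -e1.
by rewrite -new_tube_unit// e2 new_tube_unit.
Qed.

Let tubeN i : i \in I -> tubular_neighborhood A (L i) (tau i).
Proof. by move=> iI; have [tauN _ _] := tauS; exact: tauN. Qed.

Let thc_fst (p : plane R * plane R) : (fun q => (th q.1, q.2)) @ p --> (th p.1, p.2).
Proof.
apply: cvg_pair_to; last exact: cvg_snd.
apply: (@cvg_comp _ _ _ (fst : plane R * plane R -> _) th _ (nbhs p.1)).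
  exact: cvg_fst.
exact: thc.
Qed.

(** Inside a tube, [V] is pulled back to the parameters by continuity of the old tube map, then
    carried to [N] by openness of [new_tube]; far away, openness of [iota] suffices. The converse
    relation is treated with the roles exchanged, through [th']. *)
Let tube_exchange_lsc : lsc (tube_exchange r th).
Proof.
move=> y x [[fx ->]|[i [p [iI p2 p1 -> ->]]]] V Vx.
  have fr : nbhs x (far r).
    by apply: open_nbhs_nbhs; split => //; exact: (far_open hM tauS).
  have f1 : far 1 x by exact: far_mono r1 _ fx.
  apply: filterS (iota_open hM tauS surg f1 (filterI Vx fr)).
  by move=> _ [x' [Vx' fx'] <-]; exists x' => //; left.
have c1 : circle (polar_swap (th p.1, p.2)).1 by exact: circle_unit.
pose F q := tube (tau i) (polar_swap (th q.1, q.2)).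
have Fc : F @ p --> F p.
  apply: (@cvg_comp _ _ _ (fun q => (th q.1, q.2))
    (tube (tau i) \o @polar_swap R) _ (nbhs (th p.1, p.2))).
    exact: thc_fst.
  apply: (@continuous_comp _ _ _ (@polar_swap R) (tube (tau i))).
    exact: (@polar_swap_continuous R (th p.1, p.2)).
  by apply: (tube_continuous (tubeN iI)); exact: norm2_circle_neq0 c1.
have Vp : nbhs p (F @^-1` V) by apply: Fc; rewrite /F tube_circle.
have T1 : nbhs p [set q | th q.1 != 0].
  have T0 : nbhs p.1 [set w | th w != 0] by exact: (thc (near_neq0 p1)).
  exact: (near_fst T0).
have Vn : nbhs p (F @^-1` V `&` [set q | th q.1 != 0]) by exact: filterI.
have Nn := new_tube_open tauS surg iI p2 Vn.
apply: filterS Nn.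
move=> _ [q [[Vq q1] q2] <-]; exists (F q) => //; right; exists i, q; split=> //.
by rewrite /F tube_circle//; exact: circle_unit.
Qed.

Let tube_exchange_lsc' : lsc (converse (tube_exchange r th)).
Proof.
move=> x y [[fx ->]|[i [p [iI p2 p1 yE ->]]]] V Vx.
  have fr : nbhs x (far r).
    by apply: open_nbhs_nbhs; split => //; exact: (far_open hM tauS).
  have f1 : far 1 x by exact: far_mono r1 _ fx.
  have Vi : nbhs x (iota @^-1` V) by exact: (iota_continuous hM tauS surg f1).
  by apply: filterS (filterI Vi fr) => x' [Vx' fx']; exists (iota x') => //; left.
set q := polar_swap (th p.1, p.2).
have c1 : circle q.1 by exact: circle_unit.
have q1 : q.1 != 0 by exact: norm2_circle_neq0.
have q2 : q.2 != 0.
  apply: scale_neq0; first by rewrite gt_eqF ?norm2_gt0.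
  exact: norm2_circle_neq0 (circle_unit p2).
pose F q := (th' (polar_swap' q).1, (polar_swap' q).2) : plane R * plane R.
have Fq : F q = (p.1, unit_dir p.2) by rewrite /F /q polar_swapK//= thK.
have Fc : F @ q --> F q.
  have sc := polar_swap'_continuous q1 q2.
  apply: cvg_pair_to.
    apply: (@cvg_comp _ _ _ (fun q => (polar_swap' q).1) th' _
      (nbhs (polar_swap' q).1)).
      by apply: (@cvg_comp _ _ _ (@polar_swap' R) fst _ (nbhs (polar_swap' q)));
        [exact: sc|exact: cvg_fst].
    exact: thc'.
  by apply: (@cvg_comp _ _ _ (@polar_swap' R) snd _ (nbhs (polar_swap' q)));
    [exact: sc|exact: cvg_snd].
have Vn : nbhs (F q) (new_tube i @^-1` V).
  apply: (new_tube_continuous tauS surg iI).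
    by rewrite Fq; exact: norm2_circle_neq0 (circle_unit p2).
  by rewrite Fq new_tube_unit// -surjective_pairing -yE.
have Vq : nbhs q (F @^-1` (new_tube i @^-1` V)) := Fc _ Vn.
have Vq' : nbhs q (F @^-1` (new_tube i @^-1` V) `&` [set s | s.2 != 0]).
  by apply: filterI => //; exact: (near_snd (near_neq0 q2)).
have := tube_open (tubeN iI) q1 Vq'; rewrite tube_circle//; apply: filterS.
move=> _ [s [[Vs s2] /= s1] <-]; exists (new_tube i (F s)) => //; right.
have thE : th (F s).1 = (polar_swap' s).1 by rewrite /= thK'.
exists i, (F s); split=> //.
- exact: norm2_circle_neq0 (circle_unit s2).
- rewrite thE; apply: scale_neq0; first by rewrite gt_eqF ?norm2_gt0.
  exact: norm2_circle_neq0 (circle_unit s1).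
- by rewrite thE -surjective_pairing polar_swap'K.
Qed.

Lemma tube_exchange_local_homeo : local_homeo (tube_exchange r th).
Proof. by split. Qed.

(** The condition [th p.1 != 0] removes exactly the circle over [th' 0]: the core of the new solid
    torus for the identity, the meridian for [push]. *)
Lemma tube_exchange_domain y : (exists x, tube_exchange r th y x) <->
  ~ exists i z, [/\ i \in I, z != 0 & y = new_tube i (th' 0, z)].
Proof.
split=> [[x Pyx] [i [z [iI z0 yE]]]|ny].
  (* If [th' 0] had norm greater than [r], it would be fixed by [th], hence equal to 0, a
     contradiction. *)
  case: Pyx yE => [[fx ->]|[j [p [jI p2 p1 -> _]]]].
    move=> /(far_new_tube fx iI) -/(_ z0) [/= rth _].
    have := th_far rth; rewrite thK' => th0.
    by move: rth; rewrite -th0 norm20 ltNge (le_trans ler01 r1).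
  move=> /(new_tube_inj tauS surg jI iI) -/(_ p2 z0) [_ pth _].
  by rewrite pth thK' eqxx in p1.
have [[x fx ->]|[i [p [iI p2 yE]]]] := far_or_new_tube r y.
  by exists x; left.
exists (tau i (polar_swap (th p.1, p.2))); right; exists i, p; split=> //.
apply/eqP => p1; apply: ny; exists i, p.2; split=> //.
by rewrite -p1 thK -surjective_pairing.
Qed.

(** The radius in the old tube is [norm2 (th p.1)], so only radius 0 is missed; surjectivity of [th]
    yields every other radius and direction. *)
Lemma tube_exchange_codomain x : (exists y, tube_exchange r th y x) <->
  ~ exists2 i, i \in I & core (L i) x.
Proof.
have coreE i : i \in I -> core (L i) = tau i @` [set p | circle p.1 /\ p.2 = 0].
  by move=> iI; exact: (core_tube (tubeN iI)).
split=> [[y Pyx] [i iI]|nx].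
  rewrite coreE// => -[p [cp p0] px].
  case: Pyx => [[fx _]|[j [q [jI q2 q1 _ xE]]]].
    move: fx; rewrite -px => /(far_tube tauS _ iI) -/(_ cp).
    by rewrite p0 norm20 ltNge (le_trans ler01 r1).
  move: px; rewrite xE => /(tau_inj tauS iI jI cp) -/(_ (circle_unit q1)) [_ pq].
  have := norm2_polar_swap (p := (th q.1, q.2)) q2.
  by rewrite -pq p0 norm20 /= => /esym/norm2_eq0 q10; rewrite q10 eqxx in q1.
have [fx|[i [p [iI cp xE]]]] := far_or_tube I tau r x.
  by exists (iota x); left.
have p1 := norm2_circle_neq0 cp.
have p2 : p.2 != 0.
  by apply/eqP => p20; apply: nx; exists i => //; rewrite coreE// xE; exists p.
exists (new_tube i (th' (polar_swap' p).1, (polar_swap' p).2)); right.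
exists i, (th' (polar_swap' p).1, (polar_swap' p).2); rewrite thK'; split=> //.
- exact: norm2_circle_neq0 (circle_unit p2).
- by apply: scale_neq0;
    [rewrite gt_eqF ?norm2_gt0|exact: norm2_circle_neq0 (circle_unit p1)].
- by rewrite xE -surjective_pairing polar_swap'K// (unit_circle cp) -surjective_pairing.
Qed.

End TubeExchangeHomeo.
End TubeExchange.

(** * The homeomorphism between the link complements *)

Lemma circle_base_point (R : realType) : circle (base_point : plane R).
Proof. by rewrite /circle /= expr1n expr0n addr0. Qed.

Lemma core_annulus (R : realType) (M : topologicalType) (a : framed_curve R M) :
  core a `<=` annulus a.
Proof. by move=> _ [e ce <-]; exists e, 0; rewrite lexx ler01. Qed.

Theorem proposition1p3 (R : realType) (M : topologicalType)
    (A : set (chart R M)) (n : nat) (L : 'I_n -> framed_curve R M)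
    (Mstar : topologicalType) (Lstar : 'I_n -> framed_curve R Mstar) :
  closed_oriented_3manifold A ->
  framed_link A L ->
  change_of_pair A L Lstar ->
  homeomorphic_sets (~` underlying Lstar) (~` underlying L).
Proof.
move=> [hM _ _] _ [I [Lnew [tau [iota [kappa [_ LnewJ _ tauS]]]]]].
move=> [[H [_ Hhomeo _ [W [Wo LW HW]] Hmer]] LnewE surg LstarE].
have i01 : 0 <= (1 : R) <= 1 by rewrite ler01 lexx.
set h := H 1; have hh : homeomorphism h by exact: Hhomeo.
have hW x : W x -> h x = x by move=> Wx; exact: HW.
have [_ [g [_ gK hK]]] := hh.
have [tauN _ tauJ] := tauS.
(* Both relations have the complement of the cores of [L_I] as range. The domain of [Q] is [Mstar]
   without the new cores, that of [P] is [Mstar] without the meridians; the radius 4 comes from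
   [push_far]. *)
pose Q := tube_exchange I tau iota kappa 1 id.
pose P := tube_exchange I tau iota kappa 4 (@push R).
have idc : continuous (@id (plane R)) by move=> x; exact: cvg_id.
have idK : cancel (@id (plane R)) id by [].
have idfar (w : plane R) : 1 < norm2 w -> w = w by [].
have le14 : 1 <= (4 : R) by rewrite ler1n.
have Qhomeo : local_homeo Q.
  exact: (tube_exchange_local_homeo hM tauS surg (lexx 1) idc idc idK idK idfar).
have Phomeo : local_homeo P.
  exact: (tube_exchange_local_homeo hM tauS surg le14 (@push_continuous R)
    (@pull_continuous R) (@pushK R) (@pullK R) (@push_far R)).
have pull0 : pull 0 = base_point :> plane R by rewrite -push_base pushK.
have Qdom (y : Mstar) := tube_exchange_domain tauS surg (lexx 1) idK idK idfar y.
have Qcod (x : M) := tube_exchange_codomain iota kappa tauS (lexx 1) idK x.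
have Pdom (y : Mstar) :=
  tube_exchange_domain tauS surg le14 (@pushK R) (@pullK R) (@push_far R) y.
have Pcod (x : M) := tube_exchange_codomain iota kappa tauS le14 (@pullK R) x.
have coreW i : core (L i) `<=` W by move=> x Lx; apply: LW; exists i.
have Qiota x : exterior I tau x -> Q (iota x) x.
  move=> Ex; have [fx|[i [p [iI cp xE]]]] := far_or_tube I tau 1 x; first by left.
  right; have [s1 s2 ->] := iota_polar tauS surg iI cp xE Ex.
  exists i, (polar_swap' p); split=> //; rewrite -surjective_pairing polar_swap'K//.
  - by rewrite (unit_circle cp) -surjective_pairing.
  - exact: norm2_circle_neq0.
  - by apply: contraNneq s2 => p2; rewrite /polar_swap' /= p2 /unit_dir /scale /= !mulr0.
have Qbase i z : i \in I -> circle z ->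
    Q (new_tube tau iota kappa i (base_point, z)) (tau i (base_point, z)).
  move=> iI cz; have cb := circle_base_point R; right.
  exists i, (base_point, z); split=> //=.
  - exact: norm2_circle_neq0.
  - exact: norm2_circle_neq0.
  - by rewrite /polar_swap /= !unit_circle// (proj1 (circleE _) cb) scale1.
pose T := transport Q h W.
have Thomeo : local_homeo T by exact: transport_local_homeo.
(* This lets the transported homeomorphism extend over the new cores. [F] computes the position in
   the plane factor of the old tube; it tends to 0 at a new core, and by [thin_tube] the whole
   circle over a small position lies in [W]. *)
have Ocore i z : i \in I -> z != 0 ->
    interior [set y | forall x, Q y x -> W x] (new_tube tau iota kappa i (0, z)).
  move=> iI z0; have thin := thin_tube (tauN _ iI) Wo (@coreW i).
  pose F (p : plane R * plane R) := scale (norm2 p.1) (unit_dir p.2).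
  have Fc : F @ ((0, z) : plane R * plane R) --> F (0, z).
    apply: scale_cvg.
      by apply: (cvg_comp _ _ (@cvg_fst _ _ _ _ _)); exact: norm2_continuous.
    by apply: (cvg_comp _ _ (@cvg_snd _ _ _ _ _)); exact: unit_continuous.
  have F0 : F (0, z) = 0 by rewrite /F /= norm20 /scale !mul0r.
  rewrite -F0 in thin.
  have near_thin : nbhs ((0, z) : plane R * plane R)
    (F @^-1` [set v | forall e, circle e -> W (tau i (e, v))]) by exact: Fc thin.
  apply: filterS (new_tube_open tauS surg (p := (0, z)) iI z0 near_thin).
  move=> _ [q [Wq /= q2] <-] x [[fx /esym xq]|[j [p [jI p2 p1 qp ->]]]].
    have [q1 ->] := iota_new_tube tauS surg (far_exterior (lexx 1) fx) iI q2 xq.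
    apply: Wq; apply: circle_unit.
    by apply: contraTneq q1 => ->; rewrite norm20 -ltNge ltr01.
  have [ij e1 e2] := new_tube_inj tauS surg iI jI q2 p2 qp.
  move: p1; rewrite -ij /polar_swap /= -e1 -e2 => q1.
  by apply: Wq; exact: circle_unit.
have hcore x i : core (L i) (h x) -> core (L i) x.
  by move=> hx; have := hW _ (coreW _ _ hx) => /(can_inj gK) hxx; rewrite hxx in hx.
(* Off the new cores, [h x] avoids the cores of [L_I] because [x] does, so it has a [Q]-partner; on
   the new cores the identity clause applies. *)
have Ttotal y : exists y', T y y'.
  have [[x Qyx]|/Qdom/contrapT] := pselect (exists x, Q y x).
    have [y' Qy'] : exists y', Q y' (h x).
      apply/Qcod => -[i iI /hcore xi]; have /Qcod := ex_intro (fun y => Q y x) y Qyx.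
      by apply; exists i.
    by exists y'; left; exists x.
  by move=> [i [z [iI z0 ->]]]; eexists; right; split; [reflexivity|exact: Ocore].
have Tsurj y' : exists y, T y y'.
  have [[x Qyx]|/Qdom/contrapT] := pselect (exists x, Q y' x).
    have [y Qy] : exists y, Q y (g x).
      apply/Qcod => -[i iI gi]; have /Qcod := ex_intro (fun y => Q y x) y' Qyx.
      by apply; exists i => //; rewrite -[x]hK hW//; exact: coreW gi.
    by exists y; left; exists (g x) => //; rewrite hK.
  by move=> [i [z [iI z0 ->]]]; eexists; right; split; [reflexivity|exact: Ocore].
(* The image of [Lstar] under [T]: the meridians, moved onto the boundaries of the new solid tori,
   and the unchanged cores of [L_J]. *)
pose bad y := (exists i z, [/\ i \in I, z != 0 &
    y = new_tube tau iota kappa i (base_point, z)]) \/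
  (exists i x, [/\ i \notin I, core (L i) x & y = iota x]).
have LstarP y : underlying Lstar y <-> exists i x, core (Lnew i) x /\ y = iota x.
  split=> [[i _ [e ce <-]]|[i [_ [[e ce <-] ->]]]].
    by exists i, (Lnew i e 0); split; [exists e|rewrite LstarE// lexx ler01].
  by exists i => //; exists e => //; rewrite LstarE// lexx ler01.
have exteriorL i x : core (Lnew i) x -> exterior I tau x.
  by move=> /core_annulus; exact: LnewE.
have TP y y' : T y y' -> underlying Lstar y <-> bad y'.
  have [_ _ Tfun Tinj] := Thomeo.
  move=> Tyy'; rewrite LstarP; split=> [[i [x [Lx yE]]]|].
    have Qx := Qiota _ (exteriorL _ _ Lx); rewrite -yE in Qx.
    have [iI|iJ] := boolP (i \in I).
      have : meridian (tau i) (h x) by rewrite -Hmer//; exists x.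
      move=> [z cz zx]; have Qz := Qbase _ _ iI cz; rewrite zx in Qz.
      have Tyz : T y (new_tube tau iota kappa i (base_point, z)) by left; exists x.
      left; exists i, z; split=> //; first exact: norm2_circle_neq0.
      exact: Tfun Tyy' Tyz.
    (* The remaining components lie in [W], where [h] is the identity, so [T] fixes their points. *)
    right; exists i, x; rewrite LnewJ// in Lx; split=> //; rewrite -yE.
    have Tyy : T y y by left; exists x => //; rewrite hW//; exact: coreW Lx.
    exact: Tfun Tyy' Tyy.
  move=> [[i [z [iI z0 yE]]]|[i [x [iJ Lx yE]]]].
    have cz := circle_unit z0; have Qz := Qbase _ _ iI cz.
    have : (h @` core (Lnew i)) (tau i (base_point, unit_dir z)).
      by rewrite Hmer//; exists (unit_dir z).
    move=> [x Lx xz]; exists i, x; split=> //.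
    have Txy : T (iota x) y'.
      left; exists x; first exact: Qiota (exteriorL _ _ Lx).
      by rewrite yE xz -new_tube_unit.
    exact: Tinj Tyy' Txy.
  have Lx' : core (Lnew i) x by rewrite LnewJ.
  exists i, x; split=> //.
  have Txy : T (iota x) y'.
    left; exists x; first exact: Qiota (exteriorL _ _ Lx').
    by rewrite yE hW; [exact: Qiota (exteriorL _ _ Lx')|exact: coreW Lx].
  exact: Tinj Tyy' Txy.
have farJ i x : i \notin I -> core (L i) x -> P (iota x) x.
  move=> iJ /core_annulus Lx; left; split=> // -[j jI [p [cp _] px]].
  have : (open_tube (tau j) `&` annulus (L i)) x by split=> //; exists p.
  by rewrite tauJ.
(* The meridians are outside the domain of [P] and the cores of [L_I] outside its range, so only the
   components of [L_J] are compared, and [P] matches these through [iota]. *)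
have PP y x : P y x -> bad y <-> underlying L x.
  have [_ _ Pfun Pinj] := Phomeo.
  move=> Pyx; split=> [[yb|[i [x' [iJ Lx yE]]]]|[i _ Lx]].
  - have /Pdom := ex_intro (fun x => P y x) x Pyx; rewrite pull0 => nb.
    by exfalso; exact: nb yb.
  - have := farJ _ _ iJ Lx; rewrite -yE => Pyx'.
    by exists i => //; rewrite (Pfun _ _ _ Pyx Pyx').
  - have [iI|iJ] := boolP (i \in I).
      have /Pcod := ex_intro (fun y => P y x) y Pyx => nx.
      by exfalso; apply: nx; exists i.
    by right; exists i, x; split=> //; exact: Pinj Pyx (farJ _ _ iJ Lx).
(* An arbitrary map for default values: a point of [Mstar] comes from [M] or from a solid torus, so
   [M] is inhabited as soon as [Mstar] is. *)
have [back _] : {back : Mstar -> M & True}.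
  have [cover _ _ _ _] := surg.
  have : forall y : Mstar, exists x : M, True.
    by move=> y; have [[x _ _]|[i [p _]]] := cover y; [exists x|exists (tau i p)].
  by move=> /choice[f _]; exists f.
apply: (local_homeo_homeomorphic (local_homeo_comp Thomeo Phomeo) back iota).
- move=> y nLy; have [y' Tyy'] := Ttotal y.
  have nb : ~ bad y' by move=> /(TP _ _ Tyy').
  have [x Pyx] : exists x, P y' x.
    by apply/Pdom; rewrite pull0 => yb; apply: nb; left.
  by exists x; [move=> /(PP _ _ Pyx)|exists y'].
- move=> x nLx; have [y' Pyx] : exists y', P y' x.
    by apply/Pcod => -[i _ Lx]; apply: nLx; exists i.
  have nb : ~ bad y' by move=> /(PP _ _ Pyx).
  have [y Tyy'] := Tsurj y'.
  by exists y; [move=> /(TP _ _ Tyy')|exists y'].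
Qed.
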